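(* Let $\mathfrak{g}_\lambda$ be a generic oscillator Lie algebra. A linear map $\xi:\mathfrak{g}_\lambda\to\wedge^2\mathfrak{g}_\lambda$ defines a Lie bialgebra structure on $\mathfrak{g}_\lambda$ if and only if there exist $r\in\wedge^2S$, $u_0\in S$ and a derivation $J:\mathfrak{g}_\lambda\to\mathfrak{g}_\lambda$ commuting with $\mathrm{ad}_{e_{-1}}$ and satisfying $J(e_{-1})=J(e_0)=0$ such that, for any $u\in\mathfrak{g}_\lambda$, $$\xi(u)=\mathrm{ad}_u^\dagger r+2e_0\wedge\big((J+\mathrm{ad}_{u_0})(u)\big),$$ and $$\omega_{r,\mathrm{ad}_{e_{-1}}^\dagger r}-(J^\dagger\circ \mathrm{ad}_{e_{-1}}^\dagger)r=0.$$ Moreover, in this case, the Lie bracket on $\mathfrak{g}_\lambda^*$ defined by $[\alpha,\beta]^*(u)=\xi(u)(\alpha,\beta)$ is given by $$[e_0^*,\alpha]^*=2J^*\alpha-2(\mathrm{ad}^*_{e_{-1}}\alpha)(u_0)\,e_{-1}^*+i_{r_\#(\alpha)}\omega,\qquad [\alpha,\beta]^*=(\mathrm{ad}_{e_{-1}}^\dagger r)(\alpha,\beta)\,e_{-1}^*,$$ where $\alpha,\beta\in S^*$, and $e_{-1}^*$ is a central element.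
   Context: Lie bialgebra: a Lie algebra $\mathfrak{g}$ with a linear map $\xi:\mathfrak{g}\to\wedge^2\mathfrak{g}$ such that (1) $\xi$ is a 1-cocycle for the adjoint action, $\xi([u,v])=\mathrm{ad}_u\xi(v)-\mathrm{ad}_v\xi(u)$, and (2) the bracket on $\mathfrak{g}^*$ given by $[\alpha,\beta]^*(u)=\xi(u)(\alpha,\beta)$ satisfies the Jacobi identity. Oscillator Lie algebra: for $n\ge 1$ and $\lambda=(\lambda_1,\dots,\lambda_n)\in\mathbb{R}^n$ with $0<\lambda_1\le\dots\le\lambda_n$, $\mathfrak{g}_\lambda$ is the real Lie algebra with basis $e_{-1},e_0,e_i,\check e_i$ ($i=1,\dots,n$) and brackets $[e_{-1},e_j]=\lambda_j\check e_j$, $[e_{-1},\check e_j]=-\lambda_je_j$, $[e_j,\check e_j]=e_0$, the unspecified brackets being zero or given by antisymmetry. It is generic if $0<\lambda_1<\dots<\lambda_n$ and $\lambda_k\ne\lambda_i+\lambda_j$ for all $1\le i<j<k\le n$. Let $S=\mathrm{span}\{e_i,\check e_i\}_{i=1,\dots,n}$. Let $\omega$ be the 2-form on $\mathfrak{g}_\lambda$ with $i_{e_{-1}}\omega=i_{e_0}\omega=0$, $\omega(e_i,e_j)=\omega(\check e_i,\check e_j)=0$, $\omega(e_i,\check e_j)=\delta_{ij}$, where $i_v\omega=\omega(v,\cdot)$. Let $e_{-1}^*,e_0^*,e_i^*,\check e_i^*$ be the dual basis, and $S^*=\{\alpha\in\mathfrak{g}_\lambda^*:\alpha(e_{-1})=\alpha(e_0)=0\}$.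 Elements $r\in\wedge^2\mathfrak{g}_\lambda$ are regarded as skew-symmetric bilinear forms on $\mathfrak{g}_\lambda^*$, with $(v\wedge w)(\alpha,\beta)=\alpha(v)\beta(w)-\alpha(w)\beta(v)$; $r_\#:\mathfrak{g}_\lambda^*\to\mathfrak{g}_\lambda$ is defined by $\beta(r_\#(\alpha))=r(\alpha,\beta)$. By $\wedge^2S$ is meant the space of $r\in\wedge^2\mathfrak{g}_\lambda$ with $r_\#(e_{-1}^* )=r_\#(e_0^* )=0$. For $r_1,r_2\in\wedge^2\mathfrak{g}_\lambda$, $$\omega_{r_1,r_2}(\alpha,\beta)=\tfrac12\big(\omega(r_{1\#}(\alpha),r_{2\#}(\beta))+\omega(r_{2\#}(\alpha),r_{1\#}(\beta))\big).$$ For an endomorphism $J$ of $\mathfrak{g}_\lambda$, $J^*\alpha=\alpha\circ J$ is its dual and $J^\dagger$ is the endomorphism of $\wedge^2\mathfrak{g}_\lambda$ given by $(J^\dagger r)(\alpha,\beta)=r(J^*\alpha,\beta)+r(\alpha,J^*\beta)$. In particular $\mathrm{ad}_u^*\alpha=\alpha\circ\mathrm{ad}_u$, and $\mathrm{ad}_u^\dagger$ is the adjoint action of $u$ on $\wedge^2\mathfrak{g}_\lambda$. *)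

(* Defs.v *)
From HB Require Import structures.
From mathcomp Require Import all_boot all_order all_algebra.
From mathcomp Require Import reals.
From mathcomp Require Import ring.

Set Implicit Arguments.
Unset Strict Implicit.
Unset Printing Implicit Defensive.

Import Order.TTheory GRing.Theory Num.Theory.
Local Open Scope ring_scope.

(* The bilinear map U x V -> W with values f u v, in curried form.  [linfun]
   returns an unspecified linear map on functions that are not linear, so this
   is meaningful only for bilinear f; see [bilfunE]. *)
Definition bilfun (F : fieldType) (U V W : vectType F) (f : U -> V -> W) :
    'Hom(U, 'Hom(V, W)) :=
  linfun (fun u => linfun (f u)).

Lemma linfunE (F : fieldType) (U V : vectType F) (f : U -> V) :
  linear f -> forall u, linfun f u = f u.
Proof.
move=> fL u.
pose m := GRing.isLinear.Build F U V *:%R f fL.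
pose g : {linear U -> V} := HB.pack f m.
exact: (lfunE g u).
Qed.

Lemma bilfunE (F : fieldType) (U V W : vectType F) (f : U -> V -> W) :
  (forall u, linear (f u)) -> (forall v, linear (f^~ v)) ->
  forall u v, bilfun f u v = f u v.
Proof.
move=> fr fl u v; rewrite /bilfun linfunE ?linfunE // => a x y.
by apply/lfunP => z; rewrite add_lfunE scale_lfunE !linfunE // fl.
Qed.

Definition dual_space (F : fieldType) (V : vectType F) : vectType F :=
  'Hom(V, F^o).

(* Bilinear forms on the dual of V; the second exterior power of V is the
   subspace of the skew-symmetric ones (in characteristic other than 2). *)
Definition bilform (F : fieldType) (V : vectType F) : vectType F :=
  'Hom(dual_space V, 'Hom(dual_space V, F^o)).

Definition skew_form (F : fieldType) (V : vectType F) (r : bilform V) : Prop :=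
  forall alpha beta : dual_space V, r alpha beta = - r beta alpha.

Definition wedge (F : fieldType) (V : vectType F) (v w : V) : bilform V :=
  bilfun (fun alpha beta : dual_space V =>
            alpha v * beta w - alpha w * beta v : F^o).

Lemma wedgeE (F : fieldType) (V : vectType F) (v w : V) (alpha beta : dual_space V) :
  wedge v w alpha beta = alpha v * beta w - alpha w * beta v.
Proof.
by rewrite /wedge bilfunE // => [a b x y|a b x y];
   rewrite !add_lfunE !scale_lfunE /GRing.scale /=; ring.
Qed.

Definition dual_map (F : fieldType) (V : vectType F) (J : 'End(V))
  (alpha : dual_space V) : dual_space V := (alpha \o J)%VF.

Definition dagger (F : fieldType) (V : vectType F) (J : 'End(V))
    (r : bilform V) : bilform V :=
  bilfun (fun alpha beta : dual_space V =>
            r (dual_map J alpha) beta + r alpha (dual_map J beta)).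

Lemma dual_mapP (F : fieldType) (V : vectType F) (J : 'End(V)) :
  linear (@dual_map F V J).
Proof.
move=> a x y; apply/lfunP => u.
by rewrite /dual_map !(comp_lfunE, add_lfunE, scale_lfunE).
Qed.

Lemma daggerE (F : fieldType) (V : vectType F) (J : 'End(V)) (r : bilform V)
    (alpha beta : dual_space V) :
  dagger J r alpha beta = r (dual_map J alpha) beta + r alpha (dual_map J beta).
Proof.
rewrite /dagger bilfunE // => [a b x y|a b x y]; rewrite dual_mapP !linearP.
  by rewrite scalerDr !addrA; congr (_ + _); rewrite -!addrA; congr (_ + _);
     rewrite addrC.
rewrite !add_lfunE !scale_lfunE.
by rewrite scalerDr !addrA; congr (_ + _); rewrite -!addrA; congr (_ + _);
   rewrite addrC.
Qed.

(* A Lie bracket is given by its adjoint map ad : V -> End(V), so that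
   [u, v] is [ad u v]. *)
Definition is_lie_algebra (F : fieldType) (V : vectType F)
    (ad : 'Hom(V, 'End(V))) : Prop :=
  (forall u, ad u u = 0) /\
  (forall u v w, ad u (ad v w) + ad v (ad w u) + ad w (ad u v) = 0).

Definition is_derivation (F : fieldType) (V : vectType F)
    (ad : 'Hom(V, 'End(V))) (J : 'End(V)) : Prop :=
  forall u v, J (ad u v) = ad (J u) v + ad u (J v).

Definition dual_bracket (F : fieldType) (V : vectType F)
    (xi : 'Hom(V, bilform V)) (alpha beta : dual_space V) : dual_space V :=
  linfun (fun u => xi u alpha beta).

Lemma dual_bracketE (F : fieldType) (V : vectType F)
    (xi : 'Hom(V, bilform V)) (alpha beta : dual_space V) (u : V) :
  dual_bracket xi alpha beta u = xi u alpha beta.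
Proof.
by rewrite /dual_bracket linfunE // => a x y;
   rewrite linearP !add_lfunE !scale_lfunE.
Qed.

Definition is_lie_bialgebra (F : fieldType) (V : vectType F)
    (ad : 'Hom(V, 'End(V))) (xi : 'Hom(V, bilform V)) : Prop :=
  [/\ is_lie_algebra ad,
      forall u, skew_form (xi u),
      forall u v, xi (ad u v) = dagger (ad u) (xi v) - dagger (ad v) (xi u)
    & forall alpha beta gamma : dual_space V,
        dual_bracket xi alpha (dual_bracket xi beta gamma)
        + dual_bracket xi beta (dual_bracket xi gamma alpha)
        + dual_bracket xi gamma (dual_bracket xi alpha beta) = 0].

(* Indices of the basis of the oscillator algebra, in the order
   e_{-1}, e_0, e_i, \check e_i. *)
Definition osc_idx (n : nat) : finType := (unit + unit + ('I_n + 'I_n))%type.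

Notation idxm1 := (inl (inl tt)).
Notation idx0 := (inl (inr tt)).
Notation idxe i := (inr (inl i)).
Notation idxc i := (inr (inr i)).

Definition osc (R : realType) (n : nat) : vectType R :=
  {ffun osc_idx n -> R^o}.

Definition osc_basis (R : realType) (n : nat) (x : osc_idx n) : osc R n :=
  [ffun y => (y == x)%:R].

Definition em1 (R : realType) (n : nat) : osc R n := osc_basis R idxm1.
Definition e0 (R : realType) (n : nat) : osc R n := osc_basis R idx0.
Definition ee (R : realType) (n : nat) (i : 'I_n) : osc R n :=
  osc_basis R (idxe i).
Definition ec (R : realType) (n : nat) (i : 'I_n) : osc R n :=
  osc_basis R (idxc i).

Definition osc_dual_basis (R : realType) (n : nat) (x : osc_idx n) :
  dual_space (osc R n) := linfun (fun u : osc R n => u x).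

Definition em1d (R : realType) (n : nat) : dual_space (osc R n) :=
  osc_dual_basis R idxm1.
Definition e0d (R : realType) (n : nat) : dual_space (osc R n) :=
  osc_dual_basis R idx0.

Lemma osc_dual_basisE (R : realType) (n : nat) (x : osc_idx n) (u : osc R n) :
  osc_dual_basis R x u = u x.
Proof. by rewrite /osc_dual_basis linfunE // => a v w; rewrite !ffunE. Qed.

Lemma osc_sum_basis (R : realType) (n : nat) (u : osc R n) :
  u = \sum_x u x *: osc_basis R x.
Proof.
apply/ffunP => y; rewrite sum_ffunE (bigD1 y) //= big1 => [|x xy].
  by rewrite !ffunE eqxx addr0 /GRing.scale /= mulr1.
by rewrite !ffunE eq_sym (negbTE xy) /GRing.scale /= mulr0.
Qed.

Definition osc_basis_bracket (R : realType) (n : nat) (lam : 'I_n -> R)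
    (x y : osc_idx n) : osc R n :=
  match x, y with
  | idxm1, idxe j => lam j *: ec R j
  | idxe j, idxm1 => - (lam j *: ec R j)
  | idxm1, idxc j => - (lam j *: ee R j)
  | idxc j, idxm1 => lam j *: ee R j
  | idxe i, idxc j => if i == j then e0 R n else 0
  | idxc i, idxe j => if i == j then - e0 R n else 0
  | _, _ => 0
  end.

Definition osc_ad (R : realType) (n : nat) (lam : 'I_n -> R) :
    'Hom(osc R n, 'End(osc R n)) :=
  bilfun (fun u v : osc R n =>
            \sum_x \sum_y (u x * v y) *: osc_basis_bracket lam x y).

Definition osc_omega (R : realType) (n : nat) :
    'Hom(osc R n, dual_space (osc R n)) :=
  bilfun (fun u v : osc R n =>
    \sum_(i < n) (u (idxe i) * v (idxc i) - u (idxc i) * v (idxe i)) : R^o).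

Lemma osc_adE (R : realType) (n : nat) (lam : 'I_n -> R) (u v : osc R n) :
  osc_ad lam u v = \sum_x \sum_y (u x * v y) *: osc_basis_bracket lam x y.
Proof.
rewrite /osc_ad bilfunE // => [w a s t|w a s t];
  rewrite scaler_sumr -big_split; apply: eq_bigr => x _;
  rewrite scaler_sumr -big_split; apply: eq_bigr => y _ /=;
  rewrite !ffunE scalerA -scalerDl /GRing.scale /=; congr (_ *: _); ring.
Qed.

Lemma osc_ad_basis (R : realType) (n : nat) (lam : 'I_n -> R)
    (x y : osc_idx n) :
  osc_ad lam (osc_basis R x) (osc_basis R y) = osc_basis_bracket lam x y.
Proof.
rewrite osc_adE (bigD1 x) //= [X in _ + X]big1 ?addr0 => [|z zx].
  rewrite (bigD1 y) //= big1 ?addr0 => [|z zy]; rewrite !ffunE.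
    by rewrite !eqxx mulr1 scale1r.
  by rewrite (negbTE zy) mulr0 scale0r.
by apply: big1 => t _; rewrite !ffunE (negbTE zx) mul0r scale0r.
Qed.

Lemma osc_omegaE (R : realType) (n : nat) (u v : osc R n) :
  osc_omega R n u v =
  \sum_(i < n) (u (idxe i) * v (idxc i) - u (idxc i) * v (idxe i)).
Proof.
rewrite /osc_omega bilfunE // => [w a s t|w a s t];
  rewrite scaler_sumr -big_split; apply: eq_bigr => x _ /=;
  rewrite !ffunE /GRing.scale /=; ring.
Qed.

Lemma osc_sum_idx (R : realType) (n : nat) (f : osc_idx n -> R) :
  \sum_x f x = f idxm1 + f idx0 + \sum_(i < n) (f (idxe i) + f (idxc i)).
Proof.
have unit1 (g : unit -> R) : \sum_x g x = g tt.
  by rewrite (bigD1 tt) //= big1 ?addr0 // => -[].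
by rewrite !big_sumType /= !unit1 big_split.
Qed.

Lemma osc_adE_coord (R : realType) (n : nat) (lam : 'I_n -> R)
    (u v : osc R n) (x : osc_idx n) :
  osc_ad lam u v x =
    match x with
    | idxm1 => 0
    | idx0 => osc_omega R n u v
    | idxe i => lam i * (u (idxc i) * v idxm1 - u idxm1 * v (idxc i))
    | idxc i => lam i * (u idxm1 * v (idxe i) - u (idxe i) * v idxm1)
    end.
Proof.
have sum1 (f : 'I_n -> R) i : (forall j, j != i -> f j = 0) ->
    \sum_j f j = f i.
  by move=> f0; rewrite (bigD1 i) //= big1 ?addr0.
have z0 z : (0 : osc R n) z = 0 by rewrite ffunE.
have innerl a b c i w z : \sum_(j < n) (a * b j * (0 : osc R n) z
    + a * c j * (if i == j then w else 0 : osc R n) z) = a * c i * w z.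
  rewrite (sum1 _ i) => [|j ji]; rewrite z0 mulr0 add0r ?eqxx //.
  by rewrite eq_sym (negbTE ji) z0 mulr0.
have innerr a b c i w z : \sum_(j < n) (a * b j *
    (if i == j then w else 0 : osc R n) z + a * c j * (0 : osc R n) z)
    = a * b i * w z.
  rewrite (sum1 _ i) => [|j ji]; rewrite z0 mulr0 addr0 ?eqxx //.
  by rewrite eq_sym (negbTE ji) z0 mulr0.
rewrite osc_adE sum_ffunE.
under eq_bigr => y _ do rewrite sum_ffunE.
under eq_bigr => y _ do under eq_bigr => z _ do rewrite ffunE /GRing.scale /=.
under eq_bigr => y _ do rewrite osc_sum_idx.
rewrite osc_sum_idx osc_omegaE /=.
under [X in _ + X]eq_bigr => i _ do rewrite innerl innerr !z0.
under [X in _ + (_ + X)]eq_bigr => i _ do rewrite !z0 !mulr0 addr0.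
rewrite !z0 !mulr0 big1_eq !(addr0, add0r) -big_split /=.
under eq_bigr => i _ do rewrite !ffunE /GRing.scale /=.
case: x => [[[]|[]]|[k|k]] /=.
- by rewrite big1 // => i _; ring.
- by apply: eq_bigr => i _; ring.
- rewrite (sum1 _ k) => [|j /negbTE jk]; last first.
    have -> : (idxe k == idxe j :> osc_idx n) = false by rewrite eq_sym.
    by rewrite /=; ring.
  by rewrite eqxx /=; ring.
- rewrite (sum1 _ k) => [|j /negbTE jk]; last first.
    have -> : (idxc k == idxc j :> osc_idx n) = false by rewrite eq_sym.
    by rewrite /=; ring.
  by rewrite eqxx /=; ring.
Qed.

Lemma osc_is_lie_algebra (R : realType) (n : nat) (lam : 'I_n -> R) :
  is_lie_algebra (osc_ad lam).
Proof.
split=> [u|u v w]; apply/ffunP.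
  move=> [[[]|[]]|[k|k]]; rewrite osc_adE_coord ffunE //.
  - by rewrite osc_omegaE big1 // => i _; ring.
  - by ring.
  - by ring.
move=> [[[]|[]]|[k|k]]; rewrite !ffunE !osc_adE_coord ?osc_omegaE.
- by rewrite !addr0.
- by rewrite -!big_split big1 //= => i _; rewrite !osc_adE_coord; ring.
- by ring.
- by ring.
Qed.

(* In coordinates, since the dual basis identifies the coordinates of
   [osc_sharp r alpha] with the values of [r alpha]; see [osc_sharpE]. *)
Definition osc_sharp (R : realType) (n : nat) (r : bilform (osc R n))
    (alpha : dual_space (osc R n)) : osc R n :=
  [ffun x => r alpha (osc_dual_basis R x)].

Lemma osc_sharpE (R : realType) (n : nat) (r : bilform (osc R n))
    (alpha beta : dual_space (osc R n)) :
  beta (osc_sharp r alpha) = r alpha beta.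
Proof.
have {2}-> : beta = \sum_x beta (osc_basis R x) *: osc_dual_basis R x.
  apply/lfunP => u; rewrite {1}(osc_sum_basis u) linear_sum sum_lfunE.
  apply: eq_bigr => x _; rewrite linearZ scale_lfunE osc_dual_basisE.
  by rewrite /GRing.scale /= mulrC.
rewrite (osc_sum_basis (osc_sharp r alpha)) !linear_sum.
by apply: eq_bigr => x _; rewrite !linearZ ffunE; apply: mulrC.
Qed.

Definition osc_S (R : realType) (n : nat) : {vspace osc R n} :=
  <<codom (@ee R n) ++ codom (@ec R n)>>%VS.

Definition in_dual_S (R : realType) (n : nat) (alpha : dual_space (osc R n)) : Prop :=
  alpha (em1 R n) = 0 /\ alpha (e0 R n) = 0.

Definition in_wedge2_S (R : realType) (n : nat) (r : bilform (osc R n)) : Prop :=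
  [/\ skew_form r, osc_sharp r (em1d R n) = 0 & osc_sharp r (e0d R n) = 0].

Definition omega_form (R : realType) (n : nat) (r1 r2 : bilform (osc R n)) :
    bilform (osc R n) :=
  bilfun (fun alpha beta : dual_space (osc R n) =>
    2^-1 * (osc_omega R n (osc_sharp r1 alpha) (osc_sharp r2 beta)
            + osc_omega R n (osc_sharp r2 alpha) (osc_sharp r1 beta)) : R^o).

Lemma osc_sharpP (R : realType) (n : nat) (r : bilform (osc R n)) :
  linear (osc_sharp r).
Proof.
move=> a x y; apply/ffunP => z.
by rewrite !ffunE linearP add_lfunE scale_lfunE.
Qed.

Lemma omega_formE (R : realType) (n : nat) (r1 r2 : bilform (osc R n))
    (alpha beta : dual_space (osc R n)) :
  omega_form r1 r2 alpha beta =
  2^-1 * (osc_omega R n (osc_sharp r1 alpha) (osc_sharp r2 beta)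
          + osc_omega R n (osc_sharp r2 alpha) (osc_sharp r1 beta)).
Proof.
have Lr (u v w : osc R n) (a : R) : osc_omega R n u (a *: v + w)
    = a * osc_omega R n u v + osc_omega R n u w :> R by rewrite linearP.
have Ll (u v w : osc R n) (a : R) : osc_omega R n (a *: v + w) u
    = a * osc_omega R n v u + osc_omega R n w u :> R.
  by rewrite linearP add_lfunE scale_lfunE.
have sc (a b c : R) : a *: (b : R^o) + c = a * b + c by [].
rewrite /omega_form bilfunE // => [x a s t|x a s t];
  rewrite !osc_sharpP ?Lr ?Ll sc; ring.
Qed.

Definition osc_generic (R : realType) (n : nat) (lam : 'I_n -> R) : Prop :=
  [/\ forall i, 0 < lam i,
      forall i j : 'I_n, (i < j)%N -> lam i < lam j
    & forall i j k : 'I_n, (i < j)%N -> (j < k)%N -> lam k <> lam i + lam j].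

Definition osc_bialgebra_data (R : realType) (n : nat) (lam : 'I_n -> R)
    (xi : 'Hom(osc R n, bilform (osc R n)))
    (r : bilform (osc R n)) (u0 : osc R n) (J : 'End(osc R n)) : Prop :=
  [/\ in_wedge2_S r, u0 \in osc_S R n,
      [/\ is_derivation (osc_ad lam) J,
          (J \o osc_ad lam (em1 R n))%VF = (osc_ad lam (em1 R n) \o J)%VF,
          J (em1 R n) = 0 & J (e0 R n) = 0],
      forall u, xi u = dagger (osc_ad lam u) r
                       + 2 *: wedge (e0 R n) ((J + osc_ad lam u0) u)
    & omega_form r (dagger (osc_ad lam (em1 R n)) r)
      - dagger J (dagger (osc_ad lam (em1 R n)) r) = 0].

(* Main.v *)
Require Import Defs.
From HB Require Import structures.
From mathcomp Require Import all_boot all_order all_algebra.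
From mathcomp Require Import reals.
From mathcomp Require Import ring lra.

Set Implicit Arguments.
Unset Strict Implicit.
Unset Printing Implicit Defensive.

Import Order.TTheory GRing.Theory Num.Theory.
Local Open Scope ring_scope.

(** Write D for the adjoint action of e_{-1}, c and t for the dual vectors
    e_{-1}^* and e_0^*, and s^ for the linear form omega(s, .), so that the
    dual of the oscillator algebra is spanned by c, t and the s^ with s in S.
    The coadjoint action is then short: it kills c, it sends t to u^, and it
    sends s^ to a multiple of (D s)^ plus a multiple of c ([coad_om]).  A map
    xi into skew forms is a table of four functions of u: its values on the
    pairs (c, t), (c, s^), (t, s^) and (s^, s'^).

    Let xi be a Lie bialgebra structure.  The cocycle condition alone gives
    xi(e_0) = 0, because xi(e_0) is an invariant of the second exterior power
    ([xi_e0]).  For u in S it then gives that the (c, s^) values vanish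
    ([xi_c_om_eq0]), and that the (s^, s'^) values are determined by the
    (c, t) values, since what they differ by is symmetric in one pair of
    arguments and antisymmetric in another ([xi_om_om]).  Write a(u) for
    xi(u)(c, t).  The Jacobi identity for c, t, s^ says
    a(D s) a(u) = a(s) a(D u); since D^2 is negative on the coordinate planes
    of S, this forces a = 0 on S ([xi_c_t_eq0]), and the cocycle condition
    carries the vanishing over to e_{-1}: c is central ([xi_c_central]).

    Now xi is given on S by the bilinear form B(u, s) = xi(u)(t, s^).  Its
    antisymmetric part is r; its symmetric part is omega(., J .) up to a
    scalar, for an endomorphism J of S infinitesimally preserving omega.  The
    cocycle condition for e_{-1} and S says that D is skew for the symmetric
    part of B, i.e. that J commutes with D, and that the form xi(e_{-1}) on S*
    is the action of D on r.  The rest of xi(e_{-1}) is a linear form on S,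
    which u_0 accounts for as D is invertible on S ([xi_data_cocycle]).

    Conversely a map of this shape is a coboundary plus the exterior product of
    a central vector with a derivation, hence a cocycle
    ([data_cocycle_cocycle]).  Its dual bracket is
    [a, b] = a(e_0) [t, b] - b(e_0) [t, a] + rho(a, b) c with rho the action of
    D on r, so the Jacobi identity only asks that [t, .] be a derivation for
    rho ([jacobiatorE]), which is the quadratic equation
    ([dual_jacobi_iff]). *)

(** * Bilinear forms and cocycles over any Lie algebra *)

Section Forms.
Variables (R : realType) (V : vectType R).
Implicit Types (r : bilform V) (a b c : dual_space V) (u v : V) (k : R)
  (ad : 'Hom(V, 'End(V))).

(** Linearity with values in [R] rather than in the regular module [R^o], the
    form in which the arithmetic tactics can use it. *)
Lemma bilformDl r a b c : r (a + b) c = r a c + r b c :> R.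
Proof. by rewrite linearD add_lfunE. Qed.
Lemma bilformDr r a b c : r c (a + b) = r c a + r c b :> R.
Proof. by rewrite linearD. Qed.
Lemma bilformZl r k a b : r (k *: a) b = k * r a b :> R.
Proof. by rewrite linearZ scale_lfunE. Qed.
Lemma bilformZr r k a b : r a (k *: b) = k * r a b :> R.
Proof. by rewrite linearZ. Qed.
Lemma bilformNl r a b : r (- a) b = - r a b :> R.
Proof. by rewrite linearN opp_lfunE. Qed.
Lemma bilformNr r a b : r a (- b) = - r a b :> R.
Proof. by rewrite linearN. Qed.
Lemma bilform0l r b : r 0 b = 0 :> R.
Proof. by rewrite linear0 zero_lfunE. Qed.
Lemma bilform0r r b : r b 0 = 0 :> R.
Proof. by rewrite linear0. Qed.
Definition bilformE :=
  (bilformDl, bilformDr, bilformZl, bilformZr, bilformNl, bilformNr,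
   bilform0l, bilform0r).

Lemma lformD a u v : a (u + v) = a u + a v :> R. Proof. by rewrite linearD. Qed.
Lemma lformZ a k u : a (k *: u) = k * a u :> R. Proof. by rewrite linearZ. Qed.
Lemma lformN a u : a (- u) = - a u :> R. Proof. by rewrite linearN. Qed.
Lemma lform0 a : a 0 = 0 :> R. Proof. by rewrite linear0. Qed.
Lemma addlE a b u : (a + b) u = a u + b u :> R. Proof. by rewrite add_lfunE. Qed.
Lemma scalelE a k u : (k *: a) u = k * a u :> R. Proof. by rewrite scale_lfunE. Qed.
Lemma opplE a u : (- a) u = - a u :> R. Proof. by rewrite opp_lfunE. Qed.
Lemma zerolE u : (0 : dual_space V) u = 0 :> R. Proof. by rewrite zero_lfunE. Qed.
Definition lformE :=
  (lformD, lformZ, lformN, lform0, addlE, scalelE, opplE, zerolE).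

Lemma skew_form_self (r : bilform V) a : skew_form r -> r a a = 0 :> R.
Proof. by move=> rs; have : r a a = - r a a :> R := rs a a; lra. Qed.

Lemma dagger_skew (J : 'End(V)) r : skew_form r -> skew_form (dagger J r).
Proof. by move=> rs a b; rewrite !daggerE (rs a) (rs (dual_map J a)) addrC -opprD. Qed.

Lemma wedge_skew (v w : V) : skew_form (wedge v w).
Proof. by move=> a b; rewrite !wedgeE opprB [b v * _]mulrC [b w * _]mulrC. Qed.

Lemma lie_skew ad : is_lie_algebra ad -> forall x y, ad x y = - ad y x.
Proof.
move=> [alt _] x y; apply/eqP; rewrite -addr_eq0; apply/eqP.
by have := alt (x + y); rewrite (linearD ad) !add_lfunE !linearD /= !alt add0r addr0.
Qed.

(** The order of the two factors is reversed because [dual_map] is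
    contravariant. *)
Lemma dual_map_bracket ad u v a : is_lie_algebra ad ->
  dual_map (ad (ad u v)) a
  = dual_map (ad v) (dual_map (ad u) a) - dual_map (ad u) (dual_map (ad v) a).
Proof.
move=> lie; have [_ jac] := lie; apply/lfunP => w; rewrite addlE opplE !comp_lfunE.
have skew := lie_skew lie.
have -> : ad (ad u v) w = ad u (ad v w) - ad v (ad u w).
  rewrite (skew (ad u v)) -(addr0 (- _)) -(jac u v w) (skew w u) linearN.
  by rewrite addrC -addrA subrr addr0.
by rewrite !lformE.
Qed.

Lemma coboundary_cocycle ad r u v : is_lie_algebra ad ->
  dagger (ad (ad u v)) r
  = dagger (ad u) (dagger (ad v) r) - dagger (ad v) (dagger (ad u) r).
Proof.
move=> lie; apply/lfunP => a; apply/lfunP => b.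
rewrite !add_lfunE !opp_lfunE !daggerE !(dual_map_bracket u v _ lie) !bilformE.
ring.
Qed.

(** As z is central, the adjoint action only moves the second factor of
    z ^ E v, so this is the derivation rule for E. *)
Lemma wedge_cocycle ad (E : 'End(V)) (z : V) u v :
  (forall w, ad w z = 0) -> is_derivation ad E -> is_lie_algebra ad ->
  wedge z (E (ad u v)) = dagger (ad u) (wedge z (E v)) - dagger (ad v) (wedge z (E u)).
Proof.
move=> zc der lie; apply/lfunP => a; apply/lfunP => b.
have skew := lie_skew lie.
rewrite !add_lfunE !opp_lfunE !daggerE !wedgeE !comp_lfunE !zc der.
rewrite (skew (E u)) !lformE; ring.
Qed.

Lemma ad_derivation ad u : is_lie_algebra ad -> is_derivation ad (ad u).
Proof.
move=> lie v w; have [_ jac] := lie.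
have skew := lie_skew lie.
rewrite (skew (ad u v)) -[LHS]subr0 -(jac u v w) (skew w u) linearN /=.
by rewrite !opprD !opprK !addrA subrr add0r addrC.
Qed.

Lemma derivationD ad (E F : 'End(V)) :
  is_derivation ad E -> is_derivation ad F -> is_derivation ad (E + F).
Proof.
move=> dE dF u v; rewrite !add_lfunE dE dF !linearD /= !add_lfunE.
by rewrite !addrA; congr (_ + _); rewrite -!addrA; congr (_ + _); rewrite addrC.
Qed.

End Forms.

(** * The form omega and the splitting of the oscillator algebra *)

Section Oscillator.
Variables (R : realType) (n : nat) (lam : 'I_n -> R).
(* [c] and [t] are the forms e_{-1}^* and e_0^*; [om s] is the form s^ of the
   opening comment, and [om s u] is omega(s, u). *)
Notation V := (osc R n).
Notation om := (osc_omega R n).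
Notation ad := (osc_ad lam).
Notation D := (ad (em1 R n)).
Notation c := (em1d R n).
Notation t := (e0d R n).
Implicit Types (u v s x y : V) (a b : dual_space V).

Definition in_S u := u idxm1 = 0 /\ u idx0 = 0.

(** The inverse of s |-> omega(s, .) from S to S*, extended by 0 to e_{-1}^* and
    e_0^*; hence [omega_inv (om u)] is the projection of u to S. *)
Definition omega_inv a : V := [ffun x => match x with
  | idxe i => a (ec R i) | idxc i => - a (ee R i) | _ => 0 end].

Lemma omega_inv_linear : linear omega_inv.
Proof.
move=> k a b; apply/ffunP => -[[[]|[]]|[i|i]]; rewrite !ffunE ?lformE
  /GRing.scale /=; ring.
Qed.

Lemma omega_inv_S a : in_S (omega_inv a).
Proof. by split; rewrite !ffunE. Qed.

Lemma omega_invD a b : omega_inv (a + b) = omega_inv a + omega_inv b.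
Proof. by rewrite -[a]scale1r omega_inv_linear !scale1r. Qed.
Lemma omega_inv0 : omega_inv 0 = 0 :> V.
Proof. by apply/ffunP => -[[[]|[]]|[i|i]]; rewrite !ffunE ?lformE ?oppr0. Qed.
Lemma omega_invZ (k : R) a : omega_inv (k *: a) = k *: omega_inv a.
Proof. by rewrite -[_ *: a]addr0 omega_inv_linear omega_inv0 addr0. Qed.

Lemma omD u v : om (u + v) = om u + om v. Proof. exact: linearD. Qed.
Lemma omZ (k : R) u : om (k *: u) = k *: om u. Proof. exact: linearZ. Qed.
Lemma omN u : om (- u) = - om u. Proof. exact: linearN. Qed.

Lemma om_skew u v : om u v = - om v u :> R.
Proof. by rewrite !osc_omegaE -sumrN; apply: eq_bigr => i _; ring. Qed.

Lemma om_self u : om u u = 0 :> R.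
Proof. by have := om_skew u u; lra. Qed.

Lemma sum_pick (f : 'I_n -> R) i :
  (forall j, j != i -> f j = 0) -> \sum_j f j = f i.
Proof. by move=> f0; rewrite (bigD1 i) //= big1 ?addr0. Qed.

Lemma om_ee u i : om u (ee R i) = - u (idxc i) :> R.
Proof.
rewrite osc_omegaE (sum_pick (i := i)) => [|j ji]; rewrite !ffunE /= ?eqxx.
  by rewrite mulr0 sub0r mulr1.
by rewrite (inj_eq inr_inj) (inj_eq inl_inj) (negbTE ji) !mulr0 subr0.
Qed.

Lemma om_ec u i : om u (ec R i) = u (idxe i) :> R.
Proof.
rewrite osc_omegaE (sum_pick (i := i)) => [|j ji]; rewrite !ffunE /= ?eqxx.
  by rewrite mulr0 subr0 mulr1.
by rewrite (inj_eq inr_inj) (inj_eq inr_inj) (negbTE ji) !mulr0 subr0.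
Qed.

Lemma om_em1r u : om u (em1 R n) = 0 :> R.
Proof. by rewrite osc_omegaE big1 // => i _; rewrite !ffunE /=; ring. Qed.
Lemma om_e0r u : om u (e0 R n) = 0 :> R.
Proof. by rewrite osc_omegaE big1 // => i _; rewrite !ffunE /=; ring. Qed.
Lemma om_em1 : om (em1 R n) = 0.
Proof. by apply/lfunP => u; rewrite zerolE om_skew om_em1r oppr0. Qed.
Lemma om_e0 : om (e0 R n) = 0.
Proof. by apply/lfunP => u; rewrite zerolE om_skew om_e0r oppr0. Qed.

Lemma cE u : c u = u idxm1. Proof. exact: osc_dual_basisE. Qed.
Lemma tE u : t u = u idx0. Proof. exact: osc_dual_basisE. Qed.

Lemma dual_basisP a b :
  (forall x : osc_idx n, a (osc_basis R x) = b (osc_basis R x)) -> a = b.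
Proof.
move=> ab; apply/lfunP => u; rewrite (osc_sum_basis u) !linear_sum.
by apply: eq_bigr => x _; rewrite !linearZ /= ab.
Qed.

Lemma dual_decomp a :
  a = a (em1 R n) *: c + a (e0 R n) *: t + om (omega_inv a).
Proof.
apply: dual_basisP => -[[[]|[]]|[i|i]]; rewrite !lformE cE tE.
- by rewrite om_em1r !ffunE /=; ring.
- by rewrite om_e0r !ffunE /=; ring.
- by rewrite om_ee !ffunE /=; ring.
- by rewrite om_ec !ffunE /=; ring.
Qed.

Lemma vec_decomp u :
  u = u idxm1 *: em1 R n + u idx0 *: e0 R n + omega_inv (om u).
Proof.
by apply/ffunP => -[[[]|[]]|[i|i]]; rewrite !ffunE ?om_ee ?om_ec /GRing.scale /=; ring.
Qed.

Lemma omega_invK u : in_S u -> omega_inv (om u) = u.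
Proof. by move=> [u1 u0]; rewrite [RHS]vec_decomp u1 u0 !scale0r !add0r. Qed.

Lemma om_omega_inv u : om (omega_inv (om u)) = om u.
Proof.
rewrite [in RHS](vec_decomp u) !linearD !linearZ /= om_em1 om_e0.
by rewrite !scaler0 !add0r.
Qed.

Lemma om_omega_invE a u : in_S u -> om (omega_inv a) u = a u :> R.
Proof.
by move=> [u1 u0]; rewrite [in RHS](dual_decomp a) !lformE cE tE u1 u0; ring.
Qed.

Lemma in_dual_S_om a : in_dual_S a -> a = om (omega_inv a).
Proof. by move=> [a1 a0]; rewrite [LHS]dual_decomp a1 a0 !scale0r !add0r. Qed.

Lemma om_S_surj s : exists2 u, in_S u & om s = om u.
Proof. by exists (omega_inv (om s)); [exact: omega_inv_S|rewrite om_omega_inv]. Qed.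

Lemma omega_inv_c : omega_inv c = 0.
Proof. by apply/ffunP => -[[[]|[]]|[i|i]]; rewrite !ffunE ?cE ?ffunE ?oppr0. Qed.
Lemma omega_inv_t : omega_inv t = 0.
Proof. by apply/ffunP => -[[[]|[]]|[i|i]]; rewrite !ffunE ?tE ?ffunE ?oppr0. Qed.

Lemma ee_S (i : 'I_n) : in_S (ee R i). Proof. by split; rewrite !ffunE. Qed.
Lemma ec_S (i : 'I_n) : in_S (ec R i). Proof. by split; rewrite !ffunE. Qed.

Lemma omega_inv_eq0 a : (forall u, in_S u -> a u = 0 :> R) -> omega_inv a = 0.
Proof.
move=> a0; apply/ffunP => -[[[]|[]]|[i|i]]; rewrite !ffunE //.
  by rewrite a0 //; exact: ec_S.
by rewrite a0 ?oppr0 //; exact: ee_S.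
Qed.

Lemma sharp_eq0 (q : bilform V) a : (forall b, q a b = 0 :> R) -> osc_sharp q a = 0.
Proof. by move=> q0; apply/ffunP => x; rewrite !ffunE; apply: q0. Qed.

Lemma osc_S_P u : u \in osc_S R n <-> in_S u.
Proof.
split=> [uS|[u1 u0]].
  have sub (x : osc_idx n) : (forall i : 'I_n, ee R i x = 0 /\ ec R i x = 0) -> u x = 0.
    move=> h; rewrite -osc_dual_basisE -[LHS]/(osc_dual_basis R x u).
    have /subvP/(_ _ uS) : (osc_S R n <= lker (osc_dual_basis R x))%VS.
      apply/span_subvP => v; rewrite mem_cat memv_ker osc_dual_basisE.
      move=> /orP[] /codomP[i ->].
        by rewrite (h i).1.
      by rewrite (h i).2.
    by rewrite memv_ker => /eqP.
  by split; apply: sub => i; rewrite !ffunE.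
rewrite (osc_sum_basis u); apply: memv_suml => -[[[]|[]]|[i|i]] _.
- by rewrite u1 scale0r mem0v.
- by rewrite u0 scale0r mem0v.
- apply/memvZ/memv_span; rewrite mem_cat; apply/orP; left.
  exact: (codom_f (@ee R n) i).
- apply/memvZ/memv_span; rewrite mem_cat; apply/orP; right.
  exact: (codom_f (@ec R n) i).
Qed.

(** Skew forms are compared on the decomposition of the dual into the lines of
    c and t and the space S*. *)
Lemma skew_form_ext (r r' : bilform V) : skew_form r -> skew_form r' ->
  r c t = r' c t :> R ->
  (forall s, r c (om s) = r' c (om s) :> R) ->
  (forall s, r t (om s) = r' t (om s) :> R) ->
  (forall s s', r (om s) (om s') = r' (om s) (om s') :> R) -> r = r'.
Proof.
move=> rs rs' ct co t_o oo; apply/lfunP => a; apply/lfunP => b.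
have sk : forall a b, r a b = - r b a :> R by exact: rs.
have sk' : forall a b, r' a b = - r' b a :> R by exact: rs'.
rewrite (dual_decomp a) (dual_decomp b) !bilformE.
rewrite !(skew_form_self _ rs) !(skew_form_self _ rs').
rewrite (sk t c) (sk' t c) (sk (om _) c) (sk' (om _) c).
rewrite (sk (om _) t) (sk' (om _) t).
by rewrite ct !co !t_o !oo.
Qed.

Lemma ad_decomp u v :
  ad u v = u idxm1 *: D v - v idxm1 *: D u + om u v *: e0 R n.
Proof.
apply/ffunP => -[[[]|[]]|[i|i]]; rewrite !ffunE !osc_adE_coord ?om_em1
  ?zerolE ?ffunE /GRing.scale /=; ring.
Qed.

Lemma D_S u : in_S (D u).
Proof. by split; rewrite osc_adE_coord // om_em1 zerolE. Qed.

Lemma om_D u v : om (D u) v = - om u (D v) :> R.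
Proof.
rewrite !osc_omegaE -sumrN; apply: eq_bigr => i _.
by rewrite !osc_adE_coord !ffunE /=; ring.
Qed.

Lemma D_em1 : D (em1 R n) = 0.
Proof. exact: (osc_is_lie_algebra lam).1. Qed.
Lemma D_e0 : D (e0 R n) = 0.
Proof.
by apply/ffunP => -[[[]|[]]|[i|i]]; rewrite !osc_adE_coord ?om_em1 ?zerolE
  !ffunE /=; ring.
Qed.

Lemma D_idxm1 u : (D u) idxm1 = 0. Proof. exact: (D_S u).1. Qed.

Lemma D_pr u : D (omega_inv (om u)) = D u.
Proof.
rewrite [in RHS](vec_decomp u) !linearD !linearZ /= D_em1 D_e0.
by rewrite !scaler0 !add0r.
Qed.

Lemma om_D_sym s u : om (D s) u = om (D u) s :> R.
Proof. by rewrite om_D om_skew opprK. Qed.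

Lemma ad_S u v : u idxm1 = 0 -> v idxm1 = 0 -> ad u v = om u v *: e0 R n.
Proof. by move=> u0 v0; rewrite ad_decomp u0 v0 !scale0r subr0 add0r. Qed.

Lemma ad_e0 : ad (e0 R n) = 0.
Proof.
apply/lfunP => v; rewrite ad_decomp D_e0 om_e0 zerolE !ffunE /= !scale0r scaler0.
by rewrite subr0 addr0 zero_lfunE.
Qed.

(** The coadjoint action [dual_map (ad u)] on c, t and S*. *)
Lemma coad_c u : dual_map (ad u) c = 0.
Proof. by apply/lfunP => v; rewrite comp_lfunE cE osc_adE_coord zerolE. Qed.
Lemma coad_t u : dual_map (ad u) t = om u.
Proof. by apply/lfunP => v; rewrite comp_lfunE tE osc_adE_coord. Qed.
Lemma coad_om u s :
  dual_map (ad u) (om s) = om (- u idxm1 *: D s) + om (D s) u *: c.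
Proof.
apply/lfunP => v; rewrite comp_lfunE (ad_decomp u v) !lformE om_e0r cE (om_D s u).
by rewrite omZ lformE om_D; ring.
Qed.

Lemma coad_om_S u s : u idxm1 = 0 ->
  dual_map (ad u) (om s) = om (D s) u *: c.
Proof. by move=> u0; rewrite coad_om u0 oppr0 scale0r linear0 add0r. Qed.

Lemma coad_D s : dual_map D (om s) = - om (D s).
Proof. by rewrite coad_om om_em1r scale0r addr0 !ffunE /= mulr1n scaleN1r omN. Qed.

(** * Positivity of the square of the adjoint action of e_{-1} *)

(** The basis vectors of the i-th coordinate plane of S satisfy this, with l the
    square of lambda_i. *)
Definition D2_eigen x := in_S x /\ exists2 l : R, 0 < l & D (D x) = - l *: x.

Lemma D_ee (i : 'I_n) : D (ee R i) = lam i *: ec R i.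
Proof. exact: osc_ad_basis. Qed.
Lemma D_ec (i : 'I_n) : D (ec R i) = - (lam i *: ee R i).
Proof. exact: osc_ad_basis. Qed.

Hypothesis lam_gt0 : forall i, 0 < lam i.

Lemma D2_eigen_ee (i : 'I_n) : D2_eigen (ee R i).
Proof.
split; first exact: ee_S.
exists (lam i * lam i); first exact: mulr_gt0.
by rewrite D_ee linearZ /= D_ec scalerN scalerA scaleNr.
Qed.

Lemma D2_eigen_ec (i : 'I_n) : D2_eigen (ec R i).
Proof.
split; first exact: ec_S.
exists (lam i * lam i); first exact: mulr_gt0.
by rewrite D_ec linearN linearZ /= D_ee scalerA scaleNr.
Qed.

(** Minus this form is the sum of the lambda_i times the squares of the
    coordinates in the i-th plane: it is what allows division below. *)
Lemma om_D_lt0 x : in_S x -> x != 0 -> om (D x) x < 0 :> R.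
Proof.
move=> [x1 x0] nz; rewrite osc_omegaE.
rewrite (eq_bigr (fun i => - (lam i * (x (idxe i) ^+ 2 + x (idxc i) ^+ 2))));
  last first.
  by move=> i _; rewrite !osc_adE_coord !ffunE /= x1; ring.
have nneg i : 0 <= lam i * (x (idxe i) ^+ 2 + x (idxc i) ^+ 2).
  by rewrite mulr_ge0 ?addr_ge0 ?sqr_ge0 // ltW.
rewrite sumrN oppr_lt0 lt_def sumr_ge0 ?andbT //.
apply: contra nz; rewrite psumr_eq0 // => /allP z.
apply/eqP/ffunP => k; rewrite ffunE.
have zz i : (x (idxe i) == 0) && (x (idxc i) == 0).
  have /implyP/(_ isT) := z i (mem_index_enum i).
  by rewrite mulf_eq0 gt_eqF //= paddr_eq0 ?sqr_ge0 // !sqrf_eq0.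
by case: k => [[[]|[]]|[i|i]] //; case/andP: (zz i) => /eqP ? /eqP ?.
Qed.

Lemma form_S_eq0 a : (forall x, D2_eigen x -> a x = 0 :> R) -> 
  forall s, in_S s -> a s = 0 :> R.
Proof.
move=> a0 s [s1 s0]; rewrite (osc_sum_basis s) linear_sum big1 // => k _.
rewrite linearZ; case: k => [[[]|[]]|[i|i]] /=.
- by rewrite s1 scale0r.
- by rewrite s0 scale0r.
- by have /= := a0 _ (D2_eigen_ee i); rewrite /ee => ->; rewrite scaler0.
- by have /= := a0 _ (D2_eigen_ec i); rewrite /ec => ->; rewrite scaler0.
Qed.

Definition Dinv s : V := [ffun x => match x with
  | idxe i => s (idxc i) / lam i | idxc i => - s (idxe i) / lam i | _ => 0 end].

Lemma D_Dinv s : in_S s -> D (Dinv s) = s.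
Proof.
move=> [s1 s0]; apply/ffunP => -[[[]|[]]|[i|i]];
  rewrite !osc_adE_coord ?om_em1 ?zerolE ?s1 ?s0 // !ffunE /=;
  have := lam_gt0 i; move/gt_eqF/negbT => h; field; exact: h.
Qed.

Lemma om_D_surj s : exists2 s', in_S s' & om s = om (D s').
Proof.
exists (Dinv (omega_inv (om s))); first by split; rewrite ffunE.
by rewrite D_Dinv ?om_omega_inv //; apply: omega_inv_S.
Qed.

(** * The cocycle of a triple (r, u_0, J) and its dual bracket *)

Section Data.
Variables (r : bilform V) (u0 : V) (J : 'End(V)).
Hypothesis rS : in_wedge2_S r.
Hypothesis u0S : in_S u0.
Hypothesis J_der : is_derivation ad J.
Hypothesis J_D : (J \o D)%VF = (D \o J)%VF.
Hypothesis J_em1 : J (em1 R n) = 0.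
Hypothesis J_e0 : J (e0 R n) = 0.

Lemma r_c b : r c b = 0 :> R.
Proof. by case: rS => _ h _; rewrite -osc_sharpE h linear0. Qed.
Lemma r_t b : r t b = 0 :> R.
Proof. by case: rS => _ _ h; rewrite -osc_sharpE h linear0. Qed.
Lemma r_skewE a b : r a b = - r b a :> R.
Proof. by case: rS => h _ _; exact: h. Qed.

Lemma JDE u : J (D u) = D (J u).
Proof. by have /lfunP/(_ u) := J_D; rewrite !comp_lfunE. Qed.

(** J commutes with D and S is the image of D. *)
Lemma J_S u : in_S (J u).
Proof.
rewrite (vec_decomp u) !linearD !linearZ /= J_em1 J_e0 !scaler0 !add0r.
by rewrite -(D_Dinv (omega_inv_S (om u))) JDE; exact: D_S.
Qed.

Lemma dual_map_J_c : dual_map J c = 0.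
Proof. by apply/lfunP => u; rewrite comp_lfunE cE (J_S _).1 zerolE. Qed.
Lemma dual_map_J_t : dual_map J t = 0.
Proof. by apply/lfunP => u; rewrite comp_lfunE tE (J_S _).2 zerolE. Qed.

(* the restriction to S* of the cocycle at e_{-1}; see [data_cocycle_om_om] *)
Notation rho := (dagger D r).

Definition data_cocycle u : bilform V :=
  dagger (ad u) r + 2 *: wedge (e0 R n) ((J + ad u0) u).

Lemma data_cocycle_skew u : skew_form (data_cocycle u).
Proof.
move=> a b; rewrite !add_lfunE !scale_lfunE.
rewrite (dagger_skew (ad u) (let: And3 h _ _ := rS in h)) (wedge_skew _ _ a b).
by rewrite scalerN -opprD.
Qed.

Lemma data_derivation : is_derivation ad (J + ad u0).
Proof. exact: derivationD (ad_derivation _ (osc_is_lie_algebra lam)). Qed.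

Lemma data_cocycle_cocycle u v : data_cocycle (ad u v)
  = dagger (ad u) (data_cocycle v) - dagger (ad v) (data_cocycle u).
Proof.
have lie := osc_is_lie_algebra lam.
have z w : ad w (e0 R n) = 0.
  by rewrite ad_decomp D_e0 om_e0r !ffunE /= scaler0 !scale0r subr0 addr0.
apply/lfunP => a; apply/lfunP => b; rewrite /data_cocycle.
rewrite (coboundary_cocycle r u v lie).
rewrite (wedge_cocycle u v z data_derivation lie).
rewrite !(add_lfunE, opp_lfunE, scale_lfunE, daggerE) /GRing.scale /=; ring.
Qed.

Lemma data_cocycleE u a b : data_cocycle u a b =
  r (dual_map (ad u) a) b + r a (dual_map (ad u) b)
  + 2 * (a (e0 R n) * b (J u + ad u0 u) - a (J u + ad u0 u) * b (e0 R n)) :> R.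
Proof. by rewrite /data_cocycle !add_lfunE !scale_lfunE daggerE wedgeE. Qed.

(** The next three lemmas are the table of the cocycle on c, t and S*; the dual
    brackets are read off from it. *)
Lemma data_cocycle_c u b : data_cocycle u c b = 0 :> R.
Proof.
rewrite data_cocycleE coad_c !r_c !bilformE !lformE !cE (J_S _).1.
rewrite osc_adE_coord !ffunE /=.
by ring.
Qed.

Lemma data_cocycle_t_om u s : data_cocycle u t (om s) =
  r (om u) (om s) + 2 * (om s (J u) - u idxm1 * om s (D u0)) :> R.
Proof.
rewrite data_cocycleE coad_t !r_t om_e0r !lformE !tE.
rewrite (ad_decomp u0 u) !lformE om_e0r u0S.1 !ffunE /=; ring.
Qed.

Lemma data_cocycle_om_om u s s' : data_cocycle u (om s) (om s') =
  u idxm1 * rho (om s) (om s') :> R.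
Proof.
rewrite data_cocycleE daggerE !coad_D !coad_om !om_e0r !omZ !bilformE.
rewrite (r_skewE (om s) c) !r_c; ring.
Qed.

Lemma rho_c b : rho c b = 0 :> R.
Proof. by rewrite daggerE coad_c bilformE r_c addr0. Qed.
Lemma rho_t b : rho t b = 0 :> R.
Proof. by rewrite daggerE coad_t om_em1 bilformE r_t addr0. Qed.
Lemma rho_skewE a b : rho a b = - rho b a :> R.
Proof. by apply: dagger_skew; case: rS. Qed.

Variable xi : 'Hom(V, bilform V).
Hypothesis xiE : forall u, xi u = data_cocycle u.

Lemma data_xi_c u b : xi u c b = 0 :> R.
Proof. by rewrite xiE data_cocycle_c. Qed.

Lemma data_xi_t_om u s : xi u t (om s) =
  r (om u) (om s) + 2 * (om s (J u) - u idxm1 * om s (D u0)) :> R.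
Proof. by rewrite xiE data_cocycle_t_om. Qed.

Lemma data_xi_om_om u s s' : xi u (om s) (om s') = u idxm1 * rho (om s) (om s') :> R.
Proof. by rewrite xiE data_cocycle_om_om. Qed.

Lemma data_xi_skew u a b : xi u a b = - xi u b a :> R.
Proof. by rewrite xiE; apply: data_cocycle_skew. Qed.

Lemma bracket_c a : dual_bracket xi c a = 0.
Proof. by apply/lfunP => u; rewrite dual_bracketE data_xi_c zerolE. Qed.

Lemma om_sharp a u : om (osc_sharp r a) u = r (om u) a :> R.
Proof. by rewrite om_skew osc_sharpE (r_skewE a) opprK. Qed.

Lemma bracket_t_S a : in_dual_S a -> dual_bracket xi t a =
  2 *: dual_map J a - (2 * dual_map D a u0) *: c + om (osc_sharp r a).
Proof.
move=> aS; apply/lfunP => u; rewrite dual_bracketE !lformE !comp_lfunE cE om_sharp.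
rewrite (in_dual_S_om aS) data_xi_t_om; ring.
Qed.

Lemma bracket_S_S a b : in_dual_S a -> in_dual_S b ->
  dual_bracket xi a b = rho a b *: c.
Proof.
move=> aS bS; apply/lfunP => u; rewrite dual_bracketE !lformE cE.
by rewrite (in_dual_S_om aS) (in_dual_S_om bS) data_xi_om_om; ring.
Qed.

Notation E := (dual_bracket xi t).

Lemma bracket_tD a b : E (a + b) = E a + E b.
Proof. by apply/lfunP => u; rewrite addlE !dual_bracketE !bilformE. Qed.
Lemma bracket_tZ (k : R) a : E (k *: a) = k *: E a.
Proof. by apply/lfunP => u; rewrite scalelE !dual_bracketE !bilformE. Qed.
Lemma bracket_tN a : E (- a) = - E a.
Proof. by rewrite -scaleN1r bracket_tZ scaleN1r. Qed.

Lemma bracket_t_c : E c = 0.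
Proof.
by apply/lfunP => u; rewrite dual_bracketE data_xi_skew data_xi_c oppr0 zerolE.
Qed.
Lemma bracket_t_t : E t = 0.
Proof.
apply/lfunP => u; rewrite dual_bracketE zerolE.
have : xi u t t = - xi u t t :> R := data_xi_skew u t t; lra.
Qed.

Lemma bracket_t_om a : E a = E (om (omega_inv a)).
Proof.
rewrite {1}(dual_decomp a) !bracket_tD !bracket_tZ bracket_t_c bracket_t_t.
by rewrite !scaler0 !add0r.
Qed.

Lemma rho_om a b : rho a b = rho (om (omega_inv a)) (om (omega_inv b)) :> R.
Proof.
rewrite {1}(dual_decomp a) {1}(dual_decomp b) !bilformE.
by rewrite (rho_skewE (om _) c) (rho_skewE (om _) t) !rho_c !rho_t; ring.
Qed.

(** The dual bracket has the shape of a line (that of t) acting on the central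
    extension of the abelian algebra S* by c with cocycle rho. *)
Lemma bracketE a b : dual_bracket xi a b
  = a (e0 R n) *: E b - b (e0 R n) *: E a + rho a b *: c.
Proof.
apply/lfunP => u; rewrite (bracket_t_om a) (bracket_t_om b) rho_om.
rewrite !lformE !dual_bracketE cE.
rewrite {1}(dual_decomp a) {1}(dual_decomp b) !bilformE.
rewrite (data_xi_skew _ t c) (data_xi_skew _ (om _) c) (data_xi_skew _ (om _) t).
rewrite !data_xi_c data_xi_om_om.
have -> : xi u t t = 0 :> R.
  by have : xi u t t = - xi u t t :> R := data_xi_skew u t t; lra.
ring.
Qed.

Lemma data_xi_e0 : xi (e0 R n) = 0.
Proof.
apply: skew_form_ext => [a b|a b|||s|s s'].
- exact: data_xi_skew.
- by rewrite !zero_lfunE oppr0.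
- by rewrite data_xi_c !zero_lfunE.
- by move=> s; rewrite data_xi_c !zero_lfunE.
- by rewrite data_xi_t_om om_e0 J_e0 !bilformE !lformE !ffunE !zero_lfunE /=; ring.
- by rewrite data_xi_om_om !ffunE !zero_lfunE mul0r.
Qed.

Lemma bracket_e0 a b : dual_bracket xi a b (e0 R n) = 0 :> R.
Proof. by rewrite dual_bracketE data_xi_e0 !zero_lfunE. Qed.

(** The failure of [t, .] to be a derivation of the extension by rho. *)
Definition t_defect a b : R := rho (E a) b + rho a (E b).

Lemma bracket_t_comb (k l m : R) a b :
  E (k *: a - l *: b + m *: c) = k *: E a - l *: E b.
Proof.
rewrite bracket_tD bracket_tZ bracket_t_c scaler0 addr0.
by rewrite bracket_tD bracket_tN !bracket_tZ.
Qed.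

(** In the cyclic sum the iterated brackets [t, [t, .]] cancel in pairs, and
    what is left lies on the line of c. *)
Lemma jacobiatorE a b d :
  dual_bracket xi a (dual_bracket xi b d)
  + dual_bracket xi b (dual_bracket xi d a)
  + dual_bracket xi d (dual_bracket xi a b)
  = - (a (e0 R n) * t_defect b d + b (e0 R n) * t_defect d a
       + d (e0 R n) * t_defect a b) *: c.
Proof.
have nest (x y z : dual_space V) : dual_bracket xi x (dual_bracket xi y z)
    = x (e0 R n) *: (y (e0 R n) *: E (E z) - z (e0 R n) *: E (E y))
      + (y (e0 R n) * rho x (E z) - z (e0 R n) * rho x (E y)) *: c.
  rewrite (bracketE x (dual_bracket xi y z)) bracket_e0 (bracketE y z) bracket_t_comb.
  apply/lfunP => u; rewrite !lformE ?bilformE (rho_skewE x c) rho_c; ring.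
apply/lfunP => u; rewrite (nest a b d) (nest b d a) (nest d a b) !lformE /t_defect.
rewrite (rho_skewE (E b) d) (rho_skewE (E d) a) (rho_skewE (E a) b); ring.
Qed.

(** The part 2 J* of [t, .] gives the action of J on rho; its part
    s^ |-> (r_# s^)^ gives, by skewness of rho, the two terms of omega_{r,rho}. *)
Lemma t_defect_om s s' : t_defect (om s) (om s')
  = 2 * (dagger J rho (om s) (om s') - omega_form r rho (om s) (om s')).
Proof.
have Eom x : E (om x) = 2 *: dual_map J (om x)
    - (2 * dual_map D (om x) u0) *: c + om (osc_sharp r (om x)).
  by apply: bracket_t_S; split; [exact: om_em1r|exact: om_e0r].
have h x y : rho (om (osc_sharp r (om x))) (om y)
    = - om (osc_sharp r (om x)) (osc_sharp rho (om y)) :> R.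
  by rewrite rho_skewE -osc_sharpE.
rewrite /t_defect !Eom (daggerE J) omega_formE !bilformE rho_c.
rewrite (rho_skewE (om s) c) (rho_skewE (om s) (om _)) rho_c !h.
by rewrite (om_skew (osc_sharp rho (om s))); field.
Qed.

Lemma t_defectE a b : t_defect a b = t_defect (om (omega_inv a)) (om (omega_inv b)).
Proof.
rewrite /t_defect -!bracket_t_om (rho_om (E a)) (rho_om a).
by rewrite (rho_om (E a) (om _)) (rho_om (om _) (E b)) !om_omega_inv.
Qed.

(** The defect and the quadratic form vanish as soon as one argument is c or t,
    so it is enough to compare them on S*, where the identity for t, s^, s'^ is the equation. *)
Lemma dual_jacobi_iff :
  (forall a b d : dual_space V,
    dual_bracket xi a (dual_bracket xi b d)
    + dual_bracket xi b (dual_bracket xi d a)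
    + dual_bracket xi d (dual_bracket xi a b) = 0)
  <-> omega_form r rho - dagger J rho = 0.
Proof.
split=> [jac|eq0 a b d]; last first.
  have d0 (x y : dual_space V) : t_defect x y = 0.
    rewrite t_defectE t_defect_om.
    move/lfunP/(_ (om (omega_inv x)))/lfunP/(_ (om (omega_inv y))): eq0.
    rewrite !add_lfunE !opp_lfunE !zero_lfunE => /eqP; rewrite subr_eq0 => /eqP ->.
    by rewrite subrr mulr0.
  by rewrite jacobiatorE !d0 !mulr0 !addr0 oppr0 scale0r.
have omz s : om s (e0 R n) = 0 :> R := om_e0r s.
have d0 s s' : t_defect (om s) (om s') = 0.
  have := congr1 (fun f : dual_space V => f (em1 R n) : R) (jac t (om s) (om s')).
  by rewrite jacobiatorE !omz zerolE scalelE cE tE !ffunE /= => h; move: h; lra.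
have sk (x y : dual_space V) : rho x y = - rho y x :> R by exact: rho_skewE.
apply: skew_form_ext.
- move=> a b; rewrite !add_lfunE !opp_lfunE !omega_formE !(daggerE J).
  rewrite (sk (dual_map J a)) (sk a).
  rewrite (om_skew (osc_sharp r a)) (om_skew (osc_sharp rho a)).
  rewrite /GRing.scale /=; ring.
- by move=> a b; rewrite !zero_lfunE oppr0.
- rewrite !add_lfunE !opp_lfunE omega_formE (daggerE J).
  rewrite (sharp_eq0 r_c) (sharp_eq0 rho_c).
  rewrite dual_map_J_c dual_map_J_t.
  by rewrite linear0 !zero_lfunE !bilformE; ring.
- move=> s; rewrite !add_lfunE !opp_lfunE omega_formE (daggerE J).
  rewrite (sharp_eq0 r_c) (sharp_eq0 rho_c) dual_map_J_c rho_c.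
  by rewrite linear0 !zero_lfunE !bilformE; ring.
- move=> s; rewrite !add_lfunE !opp_lfunE omega_formE (daggerE J).
  rewrite (sharp_eq0 r_t) (sharp_eq0 rho_t) dual_map_J_t rho_t.
  by rewrite linear0 !zero_lfunE !bilformE; ring.
- move=> s s'; have := d0 s s'; rewrite t_defect_om.
  rewrite !add_lfunE !opp_lfunE !zero_lfunE; lra.
Qed.
End Data.

(** * The shape of a Lie bialgebra structure *)

Section Bialgebra.
Hypothesis n_gt0 : (0 < n)%N.

Lemma exists_D2_eigen : exists2 x, D2_eigen x & om (D x) x < 0 :> R.
Proof.
exists (ee R (Ordinal n_gt0)); first exact: D2_eigen_ee.
apply: om_D_lt0; first exact: ee_S.
apply/eqP => /ffunP/(_ (idxe (Ordinal n_gt0))); rewrite !ffunE eqxx => /eqP.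
by rewrite oner_eq0.
Qed.

Variable xi : 'Hom(V, bilform V).
Hypothesis xi_skew : forall u, skew_form (xi u).
Hypothesis xi_cocycle :
  forall u v, xi (ad u v) = dagger (ad u) (xi v) - dagger (ad v) (xi u).

Lemma xi_skewE u a b : xi u a b = - xi u b a :> R.
Proof. exact: xi_skew. Qed.

Lemma xi_cocycleE u v a b : xi (ad u v) a b =
  xi v (dual_map (ad u) a) b + xi v a (dual_map (ad u) b)
  - (xi u (dual_map (ad v) a) b + xi u a (dual_map (ad v) b)) :> R.
Proof. by rewrite xi_cocycle !add_lfunE !opp_lfunE !daggerE. Qed.

(** e_0 is central, so xi(e_0) is an invariant form G.  Invariance under u in S
    kills G(c, s^) and gives G(u^, s^) = omega(D s, u) G(c, t), skew on the left
    and symmetric on the right; invariance under e_{-1} kills G(t, s^). *)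
Lemma xi_e0 : xi (e0 R n) = 0.
Proof.
have inv u a b : xi (e0 R n) (dual_map (ad u) a) b
    + xi (e0 R n) a (dual_map (ad u) b) = 0 :> R.
  have := xi_cocycleE u (e0 R n) a b; rewrite ad_e0 ad_decomp om_e0r.
  have z a' : dual_map 0 a' = 0 :> dual_space V.
    by apply/lfunP => w; rewrite comp_lfunE !zero_lfunE linear0.
  rewrite !z !bilformE addr0 subr0 => <-.
  rewrite D_e0 !ffunE /= scaler0 !scale0r subr0 addr0.
  by rewrite linear0 !zero_lfunE.
have cs s : xi (e0 R n) c (om s) = 0 :> R.
  have [u [u1 u0] ->] := om_S_surj s.
  by have := inv u c t; rewrite coad_c coad_t !bilformE add0r.
have key u s : u idxm1 = 0 ->
    xi (e0 R n) (om u) (om s) = om (D s) u * xi (e0 R n) c t :> R.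
  move=> u1; have := inv u t (om s); rewrite coad_t coad_om_S // !bilformE.
  by rewrite (xi_skewE (e0 R n) t c); lra.
(* s = u isolates G(c, t), as omega(D u, u) can be nonzero *)
have ct : xi (e0 R n) c t = 0 :> R.
  have [x [[x1 _] _] neg] := exists_D2_eigen.
  have := key x x x1; rewrite skew_form_self // => /esym/eqP.
  by rewrite mulf_eq0 lt_eqF //= => /eqP.
have ts s : xi (e0 R n) t (om s) = 0 :> R.
  have [s' _ ->] := om_D_surj s.
  have := inv (em1 R n) t (om s').
  rewrite coad_t om_em1 coad_D !bilformE; lra.
apply: skew_form_ext => //.
- by move=> a b; rewrite !zero_lfunE oppr0.
- by rewrite ct !zero_lfunE.
- by move=> s; rewrite cs !zero_lfunE.
- by move=> s; rewrite ts !zero_lfunE.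
- move=> s s'; have [u [u1 u0] ->] := om_S_surj s.
  by rewrite key // ct mulr0 !zero_lfunE.
Qed.

Lemma xi_decomp u a b :
  xi u a b = u idxm1 * xi (em1 R n) a b + xi (omega_inv (om u)) a b :> R.
Proof.
rewrite {1}(vec_decomp u) !linearD !linearZ /= xi_e0.
by rewrite scaler0 addr0 !add_lfunE !scale_lfunE.
Qed.

(** The bracket of two elements of S is a multiple of e_0, where xi vanishes. *)
Lemma xi_comm_S u v a b : u idxm1 = 0 -> v idxm1 = 0 ->
  xi v (dual_map (ad u) a) b + xi v a (dual_map (ad u) b)
  = xi u (dual_map (ad v) a) b + xi u a (dual_map (ad v) b) :> R.
Proof.
move=> u0 v0; have := xi_cocycleE u v a b.
rewrite ad_S // linearZ /= xi_e0 scaler0 !zero_lfunE; lra.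
Qed.

(** Let A(u, s) = xi(u)(c, s^).  It is symmetric, skew for D, and satisfies a
    four-term identity with the definite form omega(D ., .).  On an eigenvector
    x of D^2, A and omega(D ., .) scale alike under D, so that the identity for
    x, D x gives A(x, x) = 0, and then the one for x, y gives A(y, D x) = 0. *)
Lemma xi_c_om_eq0 : forall u s, u idxm1 = 0 -> xi u c (om s) = 0 :> R.
Proof.
pose A u s : R := xi u c (om s).
have Asym u v : u idxm1 = 0 -> v idxm1 = 0 -> A u v = A v u.
  move=> u0 v0; have := xi_comm_S c t u0 v0.
  by rewrite !coad_c !coad_t !bilformE /A; lra.
have AD v s : v idxm1 = 0 -> A (D v) s = - A v (D s).
  move=> v0; rewrite /A xi_cocycleE !coad_c coad_D coad_om_S // !bilformE.
  by rewrite (skew_form_self c (xi_skew _)); ring.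
have key u v s s' : u idxm1 = 0 -> v idxm1 = 0 ->
    om (D s) u * A v s' - om (D s') u * A v s
    = om (D s) v * A u s' - om (D s') v * A u s.
  move=> u0 v0; have := xi_comm_S (om s) (om s') u0 v0.
  rewrite !coad_om_S // !bilformE (xi_skewE v (om s)) (xi_skewE u (om s)) /A; lra.
have eig0 x : D2_eigen x -> forall y, y idxm1 = 0 -> A y (D x) = 0.
  move=> [xS [l l0 DDx]] y y0; have [x1 _] := xS.
  have [->|xn0] := eqVneq x 0.
    by rewrite /A !linear0.
  have p0 := om_D_lt0 xS xn0.
  have AxDx : A x (D x) = 0.
    by have := AD x x x1; rewrite (Asym (D x) x) ?D_idxm1 //; lra.
  have Axx : A x x = 0.
    have := key x (D x) x (D x) x1 (D_idxm1 x).
    have -> : A (D x) (D x) = l * A x x.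
      by rewrite AD // DDx /A omZ !bilformE; ring.
    rewrite DDx !omZ !scalelE !om_self AxDx (om_skew x (D x)).
    rewrite !mulr0 !mul0r => h.
    have : (2 * l * om (D x) x) * A x x = 0 by move: h; lra.
    by move/eqP; rewrite !mulf_eq0 pnatr_eq0 (gt_eqF l0) (lt_eqF p0) /= => /eqP.
  have := key x y x (D x) x1 y0; rewrite AxDx Axx DDx omZ scalelE om_self.
  by rewrite !mulr0 mul0r !subr0 => /eqP; rewrite mulf_eq0 lt_eqF //= => /eqP.
(* s |-> A u (D s) is linear, so the eigenvectors suffice *)
move=> u s u0; have [s' s'S ->] := om_D_surj s.
pose f : dual_space V := (xi u c \o om \o D)%VF.
have fE x : f x = A u (D x) by rewrite /f !comp_lfunE.
rewrite -[LHS]fE; apply: form_S_eq0 s'S => x xD.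
by rewrite fE (eig0 x xD).
Qed.

(** The difference of the two sides is symmetric in u, s and antisymmetric in
    s, s', hence zero. *)
Lemma xi_om_om u s s' : u idxm1 = 0 -> s idxm1 = 0 -> s' idxm1 = 0 ->
  xi u (om s) (om s') = om (D s) u * xi s' c t - om (D s') u * xi s c t :> R.
Proof.
have key v u' z : v idxm1 = 0 -> u' idxm1 = 0 ->
    xi v (om u') (om z) - om (D z) u' * xi v c t
    = xi u' (om v) (om z) - om (D z) v * xi u' c t :> R.
  move=> v0 u0; have := xi_comm_S t (om z) v0 u0.
  rewrite !coad_t !coad_om_S // !bilformE.
  by rewrite (xi_skewE v t c) (xi_skewE u' t c); lra.
move=> u0 s0 s'0.
have := key u s s' u0 s0; have := key s s' u s0 s'0; have := key s' u s s'0 u0.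
rewrite (xi_skewE s (om u)) (xi_skewE s' (om s)) (xi_skewE u (om s')).
rewrite (om_D_sym s u) (om_D_sym s' u) (om_D_sym s' s); lra.
Qed.

Lemma xi_D_c_t v : v idxm1 = 0 -> xi (D v) c t = - xi (em1 R n) c (om v) :> R.
Proof.
move=> v0; rewrite xi_cocycleE !coad_c !coad_t om_em1 !bilformE; ring.
Qed.

Lemma dual_bracket_decomp a b :
  dual_bracket xi a b = xi (em1 R n) a b *: c + om (omega_inv (dual_bracket xi a b)).
Proof.
rewrite {1}(dual_decomp (dual_bracket xi a b)) !dual_bracketE xi_e0.
by rewrite !zero_lfunE scale0r addr0.
Qed.

Hypothesis jacobi : forall a b d : dual_space V,
  dual_bracket xi a (dual_bracket xi b d)
  + dual_bracket xi b (dual_bracket xi d a)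
  + dual_bracket xi d (dual_bracket xi a b) = 0.

(** The Jacobi identity for c, t, s^, evaluated on S.  With a = w^ on S, the
    term [s^, [c, t]] is computed by [xi_om_om] with s' = w. *)
Lemma xi_c_t_jacobi u s : in_S u -> in_S s ->
  xi (D s) c t * xi u c t = xi s c t * xi (D u) c t :> R.
Proof.
move=> uS sS; have [[u1 _] [s1 _]] := (uS, sS).
have := congr1 (fun f : dual_space V => f u : R) (jacobi c t (om s)).
rewrite !addlE !dual_bracketE zerolE.
rewrite (dual_bracket_decomp t) (dual_bracket_decomp c).
rewrite (dual_bracket_decomp (om s)).
rewrite (@omega_inv_eq0 (dual_bracket xi (om s) c)); last first.
  by move=> v [v1 _]; rewrite dual_bracketE xi_skewE xi_c_om_eq0 // oppr0.
set w := omega_inv (dual_bracket xi c t).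
have wS : in_S w by exact: omega_inv_S.
have wE v : in_S v -> om w v = xi v c t :> R.
  by move=> vS; rewrite om_omega_invE // dual_bracketE.
rewrite linear0 addr0 !bilformE xi_c_om_eq0 // (skew_form_self c (xi_skew _)).
rewrite xi_om_om ?(proj1 wS) // -(wE w) // om_self.
rewrite (om_D w u) (wE (D u)); last exact: D_S.
rewrite (xi_skewE u (om s) c) xi_c_om_eq0 // (xi_skewE u t c).
rewrite (xi_skewE _ _ c) (xi_D_c_t s1).
lra.
Qed.

(** For x in a coordinate plane and s = x, u = D x, the identity above reads
    a(D x)^2 = - l a(x)^2 with l > 0. *)
Lemma xi_c_t_eq0 u : in_S u -> xi u c t = 0 :> R.
Proof.
move=> uS; rewrite -dual_bracketE; move: u uS.
apply: form_S_eq0 => x [xS [l l0 DDx]].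
have := xi_c_t_jacobi (D_S x) xS.
rewrite DDx linearZ !scale_lfunE dual_bracketE => h.
set p : R := xi x c t in h *; set q : R := xi (D x) c t in h.
have {}h : q ^+ 2 + l * p ^+ 2 = 0.
  by have {}h : q * q = p * (- l * p) := h; move: h; nra.
have : l * p ^+ 2 = 0.
  by apply/eqP; rewrite eq_le mulr_ge0 ?sqr_ge0 ?(ltW l0) // andbT -h lerDr sqr_ge0.
by move/eqP; rewrite mulf_eq0 (gt_eqF l0) /= sqrf_eq0 => /eqP.
Qed.

Lemma xi_om_om_eq0 u s s' : in_S u -> xi u (om s) (om s') = 0 :> R.
Proof.
move=> [u1 _].
have [v vS ->] := om_S_surj s; have [v' vS' ->] := om_S_surj s'.
rewrite xi_om_om ?(proj1 vS) ?(proj1 vS') //.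
by rewrite !xi_c_t_eq0 // !mulr0 subr0.
Qed.

Lemma xi_em1_c_om s : xi (em1 R n) c (om s) = 0 :> R.
Proof.
have [v [v1 _] ->] := om_S_surj s.
by apply: oppr_inj; rewrite -xi_D_c_t // xi_c_t_eq0 ?oppr0 //; exact: D_S.
Qed.

Lemma xi_D_t_om v s : v idxm1 = 0 ->
  xi (D v) t (om s) = - xi v t (om (D s)) - xi (em1 R n) (om v) (om s)
    + om (D s) v * xi (em1 R n) c t :> R.
Proof.
move=> v0; rewrite xi_cocycleE !coad_t om_em1 coad_D coad_om_S // !bilformE.
by rewrite (xi_skewE _ t c); ring.
Qed.

(** [xi_D_t_om] at (x, x) and at (D x, D x) gives two values to the same sum,
    omega(D x, x) xi(e_{-1})(c, t) and its opposite. *)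
Lemma xi_em1_c_t : xi (em1 R n) c t = 0 :> R.
Proof.
have [x [[x1 x0] [l l0 DDx]] neg] := exists_D2_eigen.
have h1 := xi_D_t_om x x1.
have h2 := xi_D_t_om (D x) (D_idxm1 x).
move: h1 h2; rewrite !(skew_form_self _ (xi_skew _)).
have -> : xi (D (D x)) t (om (D x)) = - l * xi x t (om (D x)) :> R.
  by rewrite DDx linearZ !scale_lfunE.
have -> : xi (D x) t (om (D (D x))) = - l * xi (D x) t (om x) :> R.
  by rewrite DDx omZ !bilformE.
have -> : om (D (D x)) (D x) = l * om (D x) x :> R.
  by rewrite DDx omZ scalelE (om_skew x); ring.
move=> -> h.
have : (2 * l * om (D x) x) * xi (em1 R n) c t = 0 by move: h; lra.
move/eqP; rewrite !mulf_eq0 pnatr_eq0 (gt_eqF l0) (lt_eqF neg) /=.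
by move/eqP.
Qed.

Lemma xi_c_central u a : xi u c a = 0 :> R.
Proof.
rewrite (dual_decomp a) !bilformE (skew_form_self c (xi_skew _)).
rewrite !(xi_decomp u) xi_em1_c_t xi_em1_c_om.
have uS := omega_inv_S (om u).
by rewrite xi_c_t_eq0 // xi_c_om_eq0 ?(proj1 uS) //; ring.
Qed.

(** * The triple (r, u_0, J) of a Lie bialgebra structure *)

(** The form B of the opening comment, extended by 0 to e_{-1} and e_0. *)
Definition xiB u v : R := xi (omega_inv (om u)) t (om v).

Lemma xiB_Dl u v s : xiB (u + v) s = xiB u s + xiB v s.
Proof. by rewrite /xiB omD omega_invD linearD !add_lfunE. Qed.
Lemma xiB_Zl (k : R) u s : xiB (k *: u) s = k * xiB u s.
Proof. by rewrite /xiB omZ omega_invZ linearZ !scale_lfunE. Qed.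
Lemma xiB_Dr u v s : xiB s (u + v) = xiB s u + xiB s v.
Proof. by rewrite /xiB omD bilformDr. Qed.
Lemma xiB_Zr (k : R) u s : xiB s (k *: u) = k * xiB s u.
Proof. by rewrite /xiB omZ bilformZr. Qed.
Definition xiBE := (xiB_Dl, xiB_Zl, xiB_Dr, xiB_Zr).

Definition xi_r : bilform V :=
  bilfun (fun a b => (xiB (omega_inv a) (omega_inv b)
                      - xiB (omega_inv b) (omega_inv a)) / 2 : R^o).

Lemma xi_rE a b :
  xi_r a b = (xiB (omega_inv a) (omega_inv b)
              - xiB (omega_inv b) (omega_inv a)) / 2 :> R.
Proof.
rewrite /xi_r bilfunE // => [p k x y|p k x y];
  rewrite omega_inv_linear !xiBE /GRing.scale /=; ring.
Qed.

Lemma xi_r_om s s' : xi_r (om s) (om s') = (xiB s s' - xiB s' s) / 2 :> R.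
Proof. by rewrite xi_rE /xiB !om_omega_inv. Qed.

Lemma xiB0l s : xiB 0 s = 0.
Proof. by rewrite -(scale0r (0 : V)) xiB_Zl mul0r. Qed.
Lemma xiB0r s : xiB s 0 = 0.
Proof. by rewrite -(scale0r (0 : V)) xiB_Zr mul0r. Qed.

Lemma xi_r_wedge2S : in_wedge2_S xi_r.
Proof.
split.
- by move=> a b; rewrite !xi_rE -mulNr opprB.
- by apply: sharp_eq0 => b; rewrite xi_rE omega_inv_c xiB0l xiB0r subrr mul0r.
- by apply: sharp_eq0 => b; rewrite xi_rE omega_inv_t xiB0l xiB0r subrr mul0r.
Qed.

(** The form omega(J u, .).  The cocycle of (r, u_0, J) contributes
    2 omega(s, J u) to B(u, s), which has to be the symmetric part of B: this
    fixes the sign and the factor 4. *)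
Definition xi_b u : dual_space V :=
  linfun (fun s => - (xiB u s + xiB s u) / 4%:R : R^o).

Lemma xi_bE u s : xi_b u s = - (xiB u s + xiB s u) / 4%:R :> R.
Proof.
by rewrite /xi_b linfunE // => k x y; rewrite !xiBE /GRing.scale /=; ring.
Qed.

Definition xi_J : 'End(V) := linfun (fun u => omega_inv (xi_b u)).

Lemma xi_JE u : xi_J u = omega_inv (xi_b u).
Proof.
rewrite /xi_J linfunE // => k x y; rewrite -omega_inv_linear; congr omega_inv.
by apply/lfunP => s; rewrite !lformE !xi_bE !xiBE; ring.
Qed.

Lemma xi_J_S u : in_S (xi_J u).
Proof. by rewrite xi_JE; apply: omega_inv_S. Qed.

Lemma xiB_em1 : forall s, xiB (em1 R n) s = 0 /\ xiB s (em1 R n) = 0.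
Proof.
move=> s; rewrite /xiB om_em1 omega_inv0; split; first by rewrite linear0 !zero_lfunE.
exact: bilform0r.
Qed.
Lemma xiB_e0 : forall s, xiB (e0 R n) s = 0 /\ xiB s (e0 R n) = 0.
Proof.
move=> s; rewrite /xiB om_e0 omega_inv0; split; first by rewrite linear0 !zero_lfunE.
exact: bilform0r.
Qed.

Lemma om_xi_J u s : om (xi_J u) s = - (xiB u s + xiB s u) / 4%:R :> R.
Proof.
rewrite -xi_bE xi_JE {2}(dual_decomp (xi_b u)) !lformE !xi_bE.
rewrite !(proj1 (xiB_em1 _), proj2 (xiB_em1 _), proj1 (xiB_e0 _), proj2 (xiB_e0 _)).
ring.
Qed.

(** The cocycle condition for e_{-1} and S.  Its right-hand side is skew in u, s,
    so the symmetric part of B is skew for D ([xiB_D_sym]): this is the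
    commutation of J with D. *)
Lemma xiB_D u s :
  xiB (D u) s + xiB u (D s) = - xi (em1 R n) (om u) (om s) :> R.
Proof.
rewrite /xiB omega_invK; last exact: D_S.
rewrite -(D_pr u) xi_D_t_om; last exact: (omega_inv_S _).1.
rewrite xi_em1_c_t om_omega_inv; ring.
Qed.

Lemma xiB_D_sym u s : xiB (D u) s + xiB u (D s) + xiB (D s) u + xiB s (D u) = 0.
Proof.
have := xiB_D u s; have := xiB_D s u.
rewrite (xi_skew (em1 R n) (om s)); lra.
Qed.

Lemma xi_J_D : (xi_J \o D)%VF = (D \o xi_J)%VF.
Proof.
apply/lfunP => u; rewrite !comp_lfunE.
rewrite -[LHS]omega_invK; last exact: xi_J_S.
rewrite -[RHS]omega_invK; last exact: D_S.
congr omega_inv; apply/lfunP => s; rewrite om_D !om_xi_J.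
by have := xiB_D_sym u s => h; lra.
Qed.

Lemma xi_J_em1 : xi_J (em1 R n) = 0.
Proof.
rewrite -[LHS]omega_invK; last exact: xi_J_S.
rewrite (_ : om _ = 0); first exact: omega_inv0.
apply/lfunP => s; rewrite om_xi_J (xiB_em1 s).1 (xiB_em1 s).2 zerolE; ring.
Qed.
Lemma xi_J_e0 : xi_J (e0 R n) = 0.
Proof.
rewrite -[LHS]omega_invK; last exact: xi_J_S.
rewrite (_ : om _ = 0); first exact: omega_inv0.
apply/lfunP => s; rewrite om_xi_J (xiB_e0 s).1 (xiB_e0 s).2 zerolE; ring.
Qed.

Lemma xi_J_der : is_derivation ad xi_J.
Proof.
move=> u v; rewrite (ad_decomp u v) (ad_decomp (xi_J u)) (ad_decomp u (xi_J v)).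
rewrite !(xi_J_S _).1 !linearD linearN !linearZ /= xi_J_e0.
have JD w : xi_J (D w) = D (xi_J w) by have /lfunP/(_ w) := xi_J_D; rewrite !comp_lfunE.
rewrite !JD !scale0r scaler0 addr0 add0r addr0.
have om_sum0 : om (xi_J u) v + om u (xi_J v) = 0 :> R.
  by rewrite (om_skew u) !om_xi_J; ring.
by rewrite [RHS]addrACA -scalerDl om_sum0 scale0r addr0 addrC.
Qed.

(** Chosen so that 2 e_0 ^ [u_0, e_{-1}] has the values of xi(e_{-1}) on the
    pairs (t, s^). *)
Definition xi_u0 : V := Dinv (omega_inv (2^-1 *: (xi (em1 R n) t \o om)%VF)).

Lemma xi_u0_S : in_S xi_u0.
Proof. by split; rewrite ffunE. Qed.

Lemma om_xi_u0 s : in_S s -> om (D xi_u0) s = 2^-1 * xi (em1 R n) t (om s) :> R.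
Proof.
move=> sS; rewrite /xi_u0 D_Dinv //; last exact: omega_inv_S.
by rewrite om_omega_invE // scalelE comp_lfunE.
Qed.

Lemma xi_data_cocycle u : xi u = data_cocycle xi_r xi_u0 xi_J u.
Proof.
have central b : data_cocycle xi_r xi_u0 xi_J u c b = xi u c b :> R.
  rewrite xi_c_central.
  by rewrite (data_cocycle_c xi_u0 xi_r_wedge2S xi_J_D xi_J_em1 xi_J_e0).
apply: skew_form_ext => [|||s|s|s s'] //.
- exact: data_cocycle_skew xi_r_wedge2S _.
- have [v vS ->] := om_S_surj s.
  rewrite (data_cocycle_t_om xi_J xi_r_wedge2S xi_u0_S) xi_r_om.
  rewrite (om_skew v (xi_J u)) om_xi_J (om_skew v (D _)) om_xi_u0 //.
  by rewrite xi_decomp -/(xiB u v); field.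
rewrite (data_cocycle_om_om xi_u0 xi_J xi_r_wedge2S) daggerE !coad_D !bilformE.
rewrite !xi_r_om xi_decomp (xi_om_om_eq0 _ _ (omega_inv_S (om u))) addr0.
(* by [xiB_D] both sides are u_{-1} times a combination of values of B, equal
   because B(D ., .) + B(., D .) is skew *)
rewrite -[X in _ * X]opprK -xiB_D.
have -> : xiB (D s) s' = - xiB s (D s') - xiB (D s') s - xiB s' (D s).
  by have := xiB_D_sym s s'; lra.
by field.
Qed.
End Bialgebra.
End Oscillator.

(** * The classification *)

Theorem theorem1p1 (R : realType) (n : nat) (lam : 'I_n -> R)
    (hn : (1 <= n)%N) (hlam : osc_generic lam)
    (xi : 'Hom(osc R n, bilform (osc R n))) (hxi : forall u, skew_form (xi u)) :
  (is_lie_bialgebra (osc_ad lam) xi <->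
   exists (r : bilform (osc R n)) (u0 : osc R n) (J : 'End(osc R n)),
     osc_bialgebra_data lam xi r u0 J)
  /\
  (forall (r : bilform (osc R n)) (u0 : osc R n) (J : 'End(osc R n)),
     osc_bialgebra_data lam xi r u0 J ->
     [/\ forall alpha : dual_space (osc R n), in_dual_S alpha ->
           dual_bracket xi (e0d R n) alpha =
             2 *: dual_map J alpha
             - (2 * dual_map (osc_ad lam (em1 R n)) alpha u0) *: em1d R n
             + osc_omega R n (osc_sharp r alpha),
         forall alpha beta : dual_space (osc R n), in_dual_S alpha -> in_dual_S beta ->
           dual_bracket xi alpha beta =
             (dagger (osc_ad lam (em1 R n)) r alpha beta) *: em1d R n
       & forall alpha : dual_space (osc R n), dual_bracket xi (em1d R n) alpha = 0]).
Proof.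
have [lam_gt0 _ _] := hlam.
split; last first.
  move=> r u0 J [rS /osc_S_P u0S [_ J_D J_em1 J_e0] xiE _]; split.
  - by move=> a aS; apply: (bracket_t_S rS u0S xiE aS).
  - by move=> a b aS bS; apply: (bracket_S_S rS xiE aS bS).
  - exact: (bracket_c lam_gt0 rS J_D J_em1 J_e0 xiE).
split=> [[lie skew coc jac]
        |[r [u0 [J [rS /osc_S_P u0S [J_der J_D J_em1 J_e0] xiE quad]]]]].
  have [rS u0S] := (xi_r_wedge2S xi, xi_u0_S lam xi).
  have J_D := xi_J_D lam_gt0 hn skew coc.
  have xiE := xi_data_cocycle lam_gt0 hn skew coc jac.
  exists (xi_r xi), (xi_u0 lam xi), (xi_J xi); split=> //.
  - exact/osc_S_P.
  - by split=> //; [exact: xi_J_der|exact: xi_J_em1|exact: xi_J_e0].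
  - by apply/(dual_jacobi_iff lam_gt0 rS u0S J_D (xi_J_em1 xi) (xi_J_e0 xi) xiE).
split=> //; first exact: osc_is_lie_algebra.
  by move=> u v; rewrite !xiE; exact: data_cocycle_cocycle.
by apply/(dual_jacobi_iff lam_gt0 rS u0S J_D J_em1 J_e0 xiE).
Qed.
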